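(* Let $\mathbf A\in\mathbb C^{N\times N}$ be Hermitian, and let $\mathbf P$, $\boldsymbol\Pi$, $\mathbf Q$ be orthogonal projectors as described in the context ($\mathbf P$ of rank $M$ commuting with $\mathbf A$; $\boldsymbol\Pi$ the orthogonal projector onto $\mathcal V$; $\mathbf Q$ of rank $M$ with $\operatorname{ran}\mathbf Q\subseteq\mathcal V$ and commuting with $\boldsymbol\Pi\mathbf A\boldsymbol\Pi$). Then, for $\boldsymbol\Delta:=\mathbf Q-\mathbf P$, $$\operatorname{tr}(\mathbf A\boldsymbol\Delta)=\operatorname{tr}\big(\mathbf A(\mathbf P^\perp-\mathbf P)\boldsymbol\Delta^2\big)=\operatorname{tr}\big(\mathbf A(\mathbf I-2\mathbf P)\boldsymbol\Delta^2\big).$$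
   Context: An orthogonal projector is a matrix $\mathbf Q=\mathbf Q^2=\mathbf Q^*\in\mathbb C^{N\times N}$; $\mathbf Q^\perp:=\mathbf I-\mathbf Q$. For an orthogonal projector $\mathbf E$, $\mathbf A\!\upharpoonright_{\mathbf E}:\operatorname{ran}\mathbf E\to\operatorname{ran}\mathbf E$, $\mathbf y\mapsto\mathbf E\mathbf A\mathbf y$ is the compression of $\mathbf A$. Setting: $\mathbf A\in\mathbb C^{N\times N}$ is Hermitian. $\mathbf P\in\mathbb C^{N\times N}$ is an orthogonal projector of rank $M$ which commutes with $\mathbf A$; it is a sum of spectral projectors associated to $\mathbf A$, so that no eigenvalues of $\mathbf A\!\upharpoonright_{\mathbf P}$ and $\mathbf A\!\upharpoonright_{\mathbf P^\perp}$ coincide. $\mathcal V\subseteq\mathbb C^N$ is a subspace of dimension $r\ge M$ with associated orthogonal projector $\boldsymbol\Pi$. $\mathbf Q\in\mathbb C^{N\times N}$ is an orthogonal projector of rank $M$ such that $\operatorname{ran}\mathbf Q\subseteq\mathcal V$ and $\mathbf Q$ commutes with $\boldsymbol\Pi\mathbf A\boldsymbol\Pi$. *)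

(* Defs.v *)
From HB Require Import structures.
From mathcomp Require Export all_boot all_order all_algebra.
From mathcomp Require Export reals complex.
Set Implicit Arguments.
Unset Strict Implicit.
Unset Printing Implicit Defensive.
Import Order.TTheory GRing.Theory Num.Theory.
Local Open Scope ring_scope.
Local Open Scope sesquilinear_scope.

(* The field of complex numbers is R[i] with R : realType.  Matrices act on the
   left of column vectors; "M ^t*" is the conjugate transpose. *)
Section Projectors.
Variables (R : realType) (N : nat).
Implicit Types (A E P Q : 'M[R[i]]_N) (V : {vspace 'cV[R[i]]_N}).

Definition orthoproj Q : Prop := Q *m Q = Q /\ Q ^t* = Q.

Definition compl_proj Q : 'M[R[i]]_N := 1%:M - Q.

Definition mxend A : 'End('cV[R[i]]_N) := linfun (mulmx A).

Definition ran A : {vspace 'cV[R[i]]_N} := limg (mxend A).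

Definition orthoproj_onto V Q : Prop := orthoproj Q /\ ran Q = V.

(* vsproj (ran E) only retypes E *m (A *m y), which already lies in ran E. *)
Definition compression A E : 'End(subvs_of (ran E)) :=
  (linfun (vsproj (ran E)) \o (mxend E \o mxend A) \o linfun vsval)%VF.

Definition spectral_projector A (lambda : R[i]) E : Prop :=
  passmx.leigenvalue (mxend A) lambda /\
  orthoproj_onto (passmx.leigenspace (mxend A) lambda) E.

Definition sum_of_spectral_projectors A P : Prop :=
  exists (s : seq R[i]) (E : R[i] -> 'M[R[i]]_N),
    [/\ uniq s,
        forall lambda, lambda \in s -> spectral_projector A lambda (E lambda)
      & P = \sum_(lambda <- s) E lambda].

Definition no_common_compression_eigenvalue A P : Prop :=
  forall lambda : R[i],
    ~ (passmx.leigenvalue (compression A P) lambda /\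
       passmx.leigenvalue (compression A (compl_proj P)) lambda).

End Projectors.

(* Main.v *)
Require Import Defs.
Set Implicit Arguments.
Unset Strict Implicit.
Unset Printing Implicit Defensive.
Import Order.TTheory GRing.Theory Num.Theory.
Local Open Scope ring_scope.

(** The identity is purely algebraic.  Split matrices into blocks along the
    decomposition I = P + P^perp.  For two idempotents P and Q, the square of
    Delta = Q - P is block diagonal, with blocks - P Delta P and
    P^perp Delta P^perp; hence (P^perp - P) Delta^2 is exactly the block
    diagonal part of Delta, i.e. Delta minus the off-diagonal blocks
    P Q P^perp and P^perp Q P ([refl_mul_sqr_sub_idem]).  Since A commutes
    with P it is block diagonal as well, so the off-diagonal blocks do not
    contribute to the trace against A ([mxtrace_offdiag_eq0]). *)

(** By cyclicity the trace is that of F A E X, and moving A across E exposes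
    the product F E; with E and F complementary projectors this is the
    vanishing of the trace of an off-diagonal block. *)
Lemma mxtrace_offdiag_eq0 (K : comPzRingType) (n : nat) (A E F X : 'M[K]_n) :
  E *m A = A *m E -> F *m E = 0 -> \tr (A *m (E *m X *m F)) = 0.
Proof.
move=> EA FE0.
rewrite !mulmxA mxtrace_mulC !mulmxA -(mulmxA F) -EA mulmxA FE0.
by rewrite !mul0mx mxtrace0.
Qed.

(** Expanding gives (Q - P)^2 = Q - QP - PQ + P; multiplying by 1 - 2P turns
    this into Q - P - QP - PQ + 2 PQP, whose terms other than Q - P
    are the two off-diagonal blocks of Q, with opposite sign. *)
Lemma refl_mul_sqr_sub_idem (K : pzRingType) (P Q : K) :
  P * P = P -> Q * Q = Q ->
  (1 - P - P) * (Q - P) ^+ 2 = (Q - P) - (P * Q * (1 - P) + (1 - P) * Q * P).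
Proof.
move=> PP QQ.
have -> : (Q - P) ^+ 2 = Q - Q * P - P * Q + P.
  by rewrite expr2 mulrBl !mulrBr QQ PP opprB addrA addrAC.
have PD : P * (Q - Q * P - P * Q + P) = P - P * Q * P.
  by rewrite mulrDr !mulrBr !mulrA PP (addrAC (P * Q)) subrr sub0r addrC.
rewrite !mulrBl PD !mul1r mulrBr mulr1.
rewrite !opprD !opprK !addrA addrK.
by rewrite [LHS](ACl (1*5*3*4*2*6)).
Qed.

(** [refl_mul_sqr_sub_idem] replaces the right-hand side by the trace of A
    against Q - P minus its off-diagonal blocks, which [mxtrace_offdiag_eq0]
    kills. *)
Lemma mxtrace_mul_sub_idem (K : comPzRingType) (n : nat) (A P Q : 'M[K]_n) :
  P *m P = P -> Q *m Q = Q -> P *m A = A *m P ->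
  \tr (A *m (Q - P)) = \tr (A *m (1%:M - P - P) *m (Q - P) ^+ 2).
Proof.
move=> PP QQ PA.
have cPA : (1%:M - P) *m A = A *m (1%:M - P).
  by rewrite mulmxBl mulmxBr mul1mx mulmx1 PA.
have cPP0 : (1%:M - P) *m P = 0 by rewrite mulmxBl mul1mx PP subrr.
have PcP0 : P *m (1%:M - P) = 0 by rewrite mulmxBr mulmx1 PP subrr.
have block_diag : (1%:M - P - P) *m (Q - P) ^+ 2
    = (Q - P) - (P *m Q *m (1%:M - P) + (1%:M - P) *m Q *m P).
  (* The product of the ring of square matrices is convertible to *m. *)
  exact: (refl_mul_sqr_sub_idem PP QQ).
rewrite -mulmxA block_diag (mulmxBr A (Q - P)) (mulmxDr A (P *m Q *m _)).
rewrite (raddfB _ (A *m (Q - P))) /= mxtraceD.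
rewrite (mxtrace_offdiag_eq0 _ PA cPP0) (mxtrace_offdiag_eq0 _ cPA PcP0).
by rewrite addr0 subr0.
Qed.

Theorem lemma2p5 (R : realType) (N M r : nat)
    (A P Pi Q : 'M[R[i]]_N) (V : {vspace 'cV[R[i]]_N})
    (hA : A \is hermsymmx)
    (hP : orthoproj P) (hPrank : \rank P = M) (hPA : P *m A = A *m P)
    (hPspec : sum_of_spectral_projectors A P)
    (hPeig : no_common_compression_eigenvalue A P)
    (hVdim : \dim V = r) (hMr : (M <= r)%N) (hPi : orthoproj_onto V Pi)
    (hQ : orthoproj Q) (hQrank : \rank Q = M) (hQV : (ran Q <= V)%VS)
    (hQA : Q *m (Pi *m A *m Pi) = (Pi *m A *m Pi) *m Q) :
  let Delta := Q - P in
  \tr (A *m Delta) = \tr (A *m (compl_proj P - P) *m Delta ^+ 2) /\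
  \tr (A *m (compl_proj P - P) *m Delta ^+ 2)
    = \tr (A *m (1%:M - 2%:R *: P) *m Delta ^+ 2).
Proof.
have [[PP _] [QQ _]] := (hP, hQ).
move=> Delta; split; first exact: mxtrace_mul_sub_idem.
by rewrite /compl_proj scaler_nat mulr2n opprD addrA.
Qed.
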